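(* Let $n\ge 1$ and $q\ge 2$. Every tight minimal subcube cover of $\{0,\dots,q-1\}^n$ has size at least $(q-1)n+1$.
   Context: A subcube of $\{0,\dots,q-1\}^n$ is a set $\{x: x_{i_1}=b_1,\dots,x_{i_d}=b_d\}$, identified with a word in $\{0,\dots,q-1,*\}^n$. A subcube cover is a collection of subcubes whose union is $\{0,\dots,q-1\}^n$; it is minimal if no proper subcollection is a subcube cover; it is tight if for every coordinate $i\in[n]$ some subcube $s$ in it has $s_i\ne *$. The size is the number of subcubes. *)

(* Defs.v *)
From mathcomp Require Import all_boot.

Set Implicit Arguments.
Unset Strict Implicit.
Unset Printing Implicit Defensive.

Definition point (n q : nat) := {ffun 'I_n -> 'I_q}.

(* A word in {0, ..., q-1, *}^n: the star is encoded as None. For 1 < q,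
   distinct words denote distinct sets of points. *)
Definition subcube (n q : nat) := {ffun 'I_n -> option 'I_q}.

Definition points_of (n q : nat) (s : subcube n q) : {set point n q} :=
  [set x : point n q | [forall i, (s i == None) || (s i == Some (x i))]].

Definition subcube_cover (n q : nat) (F : {set subcube n q}) : Prop :=
  \bigcup_(s in F) points_of s = [set: point n q].

Definition minimal_cover (n q : nat) (F : {set subcube n q}) : Prop :=
  subcube_cover F /\
  forall G : {set subcube n q}, G \proper F -> ~ subcube_cover G.

Definition tight (n q : nat) (F : {set subcube n q}) : Prop :=
  forall i : 'I_n, exists2 s : subcube n q, s \in F & s i <> None.

(* Main.v *)
Require Import Defs.
From mathcomp Require Import all_boot.

(** Tarsi's argument, with Hall's theorem replaced by a direct induction.
    Restrict coordinate [i] to a nonempty domain [D i]; it can then be used to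
    escape [#|D i| - 1] subcubes. If every subfamily [H] has at most
    [\sum_(i in vars H) (#|D i| - 1)] members, then some point of the product of
    the domains escapes the whole family. Hence a cover has a subfamily [G]
    with more than [(q - 1) * #|vars G|] members; take a largest one. If [G] were
    proper, minimality would give a point escaping [G]; freezing its
    coordinates on [vars G], the maximality of [G] gives the Hall condition for
    the remaining subcubes, so some point escapes them all. *)

Section Escape.

Set Implicit Arguments.
Unset Strict Implicit.

Variables n q : nat.
Implicit Types (F G H K : {set subcube n q}) (V W : {set 'I_n}).
Implicit Types (D : 'I_n -> {set 'I_q}) (x y : point n q).

Definition vars F : {set 'I_n} := [set i | [exists s in F, s i != None]].

Definition capacity D V := \sum_(i in V) #|D i|.-1.

Definition freeze D V x i := if i \in V then [set x i] else D i.

Lemma varsP F i : reflect (exists2 s, s \in F & s i != None) (i \in vars F).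
Proof. by rewrite inE; apply: exists_inP. Qed.

Lemma varsU F G : vars (F :|: G) = vars F :|: vars G.
Proof.
apply/setP=> i; rewrite in_setU; apply/varsP/orP.
  by case=> s /setUP[sF|sG] si; [left|right]; apply/varsP; exists s.
by case=> /varsP[s sF si]; exists s => //; rewrite inE sF ?orbT.
Qed.

Lemma points_of_eq_in F s x y : s \in F -> {in vars F, x =1 y} ->
  (x \in points_of s) = (y \in points_of s).
Proof.
move=> sF xy; rewrite !inE; apply: eq_forallb => i.
case si: (s i == None) => //=; rewrite xy //.
by apply/varsP; exists s; rewrite ?si.
Qed.

Lemma capacityU D V W : capacity D (V :|: W) = capacity D V + capacity D (W :\: V).
Proof.
rewrite /capacity (big_setID V) /= setIUl setIid (setUidPl (subsetIr _ _)).
by rewrite setDUl setDv set0U.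
Qed.

(** A frozen coordinate has a singleton domain, which contributes zero. *)
Lemma capacity_freeze D V W x : capacity (freeze D V x) W = capacity D (W :\: V).
Proof.
rewrite /capacity (big_setID V) /= big1 ?add0n => [|i /setIP[_ iV]].
  by apply: eq_bigr => i /setDP[_ /negPf iV]; rewrite /freeze iV.
by rewrite /freeze iV cards1.
Qed.

Lemma freeze_neq0 D V x : (forall i, D i != set0) -> forall i, freeze D V x i != set0.
Proof.
by move=> D0 i; rewrite /freeze; case: ifP => // _; apply/set0Pn; exists (x i); apply: set11.
Qed.

Lemma capacity_remove D V i b :
  capacity D V <= (capacity (fun j => if j == i then D j :\ b else D j) V).+1.
Proof.
set D' := fun j => _.
have D'D j : j != i -> D' j = D j by rewrite /D' => /negPf->.
have [iV|iV] := boolP (i \in V); last first.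
  rewrite leqW //; apply: leq_sum => j jV; rewrite D'D //.
  by apply: contraNneq iV => <-.
rewrite /capacity !(bigD1 i iV) /= -addSn leq_add //.
  rewrite /D' eqxx (cardsD1 b (D i)); case: (b \in D i) => //=.
  by rewrite leqSpred.
by apply: leq_sum => j /andP[_ ji]; rewrite D'D.
Qed.

(** Induction on [#|F|]. Either a nonempty proper subfamily exhausts its capacity, and the family
    splits there, or there is slack everywhere and one value can be spent on escaping a single
    subcube. *)
Lemma escape F D :
    (forall i, D i != set0) ->
    (forall H, H \subset F -> #|H| <= capacity D (vars H)) ->
  exists2 x : point n q, forall i, x i \in D i & {in F, forall s, x \notin points_of s}.
Proof.
have [m] := ubnP #|F|; elim: m F D => // m IHm F D leFm D0 hall.
have [->|[s sF]] := set_0Vmem F.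
  have /fin_all_exists[x xD] i : exists b, b \in D i by apply/set0Pn.
  by exists (finfun x) => [i|s]; rewrite ?ffunE ?inE.
case: (pickP [pred H : {set subcube n q} |
         [&& H \proper F, H != set0 & capacity D (vars H) <= #|H|]]).
- move=> H /and3P[pHF H0 tightH]; have sHF := proper_sub pHF.
  have ltF G : G \proper F -> #|G| < m.
    by move=> /proper_card ltGF; apply: leq_trans ltGF _.
  have hallH K : K \subset H -> #|K| <= capacity D (vars K).
    by move=> sKH; apply/hall/(subset_trans sKH).
  have [y yD yH] := IHm H D (ltF H pHF) D0 hallH.
  have pFH : F :\: H \proper F.
    rewrite properEneq subsetDl andbT; apply: contraNneq H0 => eqF.
    by rewrite -subset0 -(setDv F) -{2}eqF setDDr setDv set0U subsetI sHF subxx.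
  (* Apply the Hall condition to [H :|: K] and cancel the share of [H], whose capacity is at most
     [#|H|]. *)
  have hallFH K : K \subset F :\: H ->
      #|K| <= capacity (freeze D (vars H) y) (vars K).
    rewrite subsetD => /andP[sKF dKH].
    have := hall (H :|: K); rewrite subUset sHF sKF => /(_ isT).
    rewrite varsU capacityU -(capacity_freeze _ _ _ y) cardsU.
    rewrite setIC (disjoint_setI0 dKH) cards0 subn0 => le1.
    by rewrite -(leq_add2l #|H|) (leq_trans le1) // leq_add2r.
  have [x xD xFH] := IHm _ _ (ltF _ pFH) (freeze_neq0 (vars H) y D0) hallFH.
  have xy i : i \in vars H -> x i = y i.
    by move=> iH; have := xD i; rewrite /freeze iH inE => /eqP.
  exists x => [i|t tF].
    by have := xD i; rewrite /freeze; case: ifP => // iH; rewrite inE => /eqP->.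
  have [tH|tH] := boolP (t \in H); first by rewrite (points_of_eq_in tH xy) yH.
  by apply: xFH; rewrite inE tH.
- move=> slack.
  (* The Hall condition for [s] alone gives a coordinate fixed by [s] with at least two values
     available. *)
  have [i isv ltDi] : exists2 i, i \in vars [set s] & 0 < #|D i|.-1.
    have := hall [set s]; rewrite sub1set sF cards1 lt0n sum_nat_eq0.
    move=> /(_ isT) /forall_inPn[i isv Di0].
    by exists i; rewrite // lt0n.
  have [b sib] : exists b, s i = Some b.
    by case/varsP: isv => t /set1P->; case: (s i) => // b _; exists b.
  (* Forbidding the value [b] at [i] escapes [s] and keeps the domain nonempty. *)
  pose D' j := if j == i then D j :\ b else D j.
  have [|j|K sK|x xD xF] := IHm (F :\ s) D'.
  + by move: leFm; rewrite (cardsD1 s) sF.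
  + rewrite /D'; case: (j =P i) => // ->; rewrite -card_gt0.
    have := ltDi; rewrite (cardsD1 b); case: (b \in D i) => //=.
    by rewrite add0n => /leq_trans; apply; apply: leq_pred.
  (* For nonempty [K] the strict slack pays for the unit of capacity lost with [b]. *)
  + have [->|K0] := eqVneq K set0; first by rewrite cards0.
    have pKF : K \proper F := sub_proper_trans sK (properD1 sF).
    have := slack K; rewrite /= pKF K0 /= => /negbT; rewrite -ltnNge => ltK.
    by rewrite -ltnS (leq_trans ltK) // capacity_remove.
  exists x => [j|t tF].
    by have := xD j; rewrite /D'; case: ifP => // _ /setD1P[].
  have [->|ts] := eqVneq t s; last by apply: xF; rewrite !inE ts.
  rewrite inE; apply/forallPn; exists i; rewrite sib /=.
  have := xD i; rewrite /D' eqxx => /setD1P[xb _].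
  by apply: contraNneq xb => -[->].
Qed.

Lemma coverPn F : ~ subcube_cover F -> exists x, {in F, forall s, x \notin points_of s}.
Proof.
move=> ncF; have /existsP[x /forall_inP xF] :
  [exists x : point n q, [forall s in F, x \notin points_of s]].
  apply/existsPn=> /= noesc; apply: ncF; apply/setP=> x; rewrite in_setT.
  by have /forall_inPn[s sF /negPn xs] := noesc x; apply/bigcupP; exists s.
by exists x.
Qed.

Lemma cover_notin F x : subcube_cover F -> ~ {in F, forall s, x \notin points_of s}.
Proof.
move=> cF xF; have : x \in \bigcup_(s in F) points_of s by rewrite cF inE.
by case/bigcupP=> s /xF/negPf->.
Qed.

Lemma minimal_cover_deficient F D :
    minimal_cover F -> (forall i, D i != set0) ->
  capacity D (vars F) < #|F|.
Proof.
move=> [cF minF] D0.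
pose P := [pred G : {set subcube n q} | (G \subset F) && (capacity D (vars G) < #|G|)].
case: (pickP P) => [G0 PG0|noP]; last first.
  have [H sHF|x _] := escape (F := F) D0; last by move/(cover_notin cF).
  by have := noP H; rewrite /= sHF /= => /negbT; rewrite -leqNgt.
have [G /andP[sGF ltG] maxG] := arg_maxnP (fun G : {set subcube n q} => #|G|) PG0.
have [<- //|neqGF] := eqVneq G F.
have pGF : G \proper F by rewrite properEneq neqGF.
have [y yG] := coverPn (minF G pGF).
have [|H|x xD xFG] := escape (F := F :\: G) (D := freeze D (vars G) y).
- exact: freeze_neq0.
- rewrite subsetD => /andP[sHF dHG]; rewrite leqNgt; apply/negP=> ltH.
  have cardGH : #|G :|: H| = #|G| + #|H|.
    by rewrite cardsU setIC (disjoint_setI0 dHG) cards0 subn0.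
  (* Capacities add up, so a violating [H] would enlarge [G]; such an [H] is nonempty, against
     maximality. *)
  have /maxG : P (G :|: H).
    rewrite /= subUset sGF sHF /= varsU capacityU -(capacity_freeze _ _ _ y) cardGH.
    by rewrite -addSn leq_add // ltnW.
  by rewrite /= cardGH -{2}[#|G|]addn0 leq_add2l leqNgt (leq_ltn_trans _ ltH).
have xy i : i \in vars G -> x i = y i.
  by move=> iG; have := xD i; rewrite /freeze iG inE => /eqP.
case: (cover_notin (x := x) cF) => s sF.
have [sG|sG] := boolP (s \in G); first by rewrite (points_of_eq_in sG xy) yG.
by apply: xFG; rewrite inE sG.
Qed.

End Escape.

Theorem theorem3p12 (n q : nat) (hn : 1 <= n) (hq : 2 <= q)
    (F : {set subcube n q}) (hmin : minimal_cover F) (htight : tight F) :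
  (q - 1) * n + 1 <= #|F|.
Proof.
(* Tightness makes all [n] coordinates count; with full domains each has capacity [q - 1]. *)
have varsF : vars F = setT.
  by apply/setP=> i; rewrite in_setT; apply/varsP; have [s sF /eqP si] := htight i; exists s.
have D0 (i : 'I_n) : [set: 'I_q] != set0 by rewrite -card_gt0 cardsT card_ord ltnW.
have := minimal_cover_deficient hmin D0.
by rewrite varsF /capacity sum_nat_const !cardsT !card_ord mulnC -subn1 addn1.
Qed.
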